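(* In the concurrent tree algorithm described in the context, for every operation $Op$ and every tree node $v$ on $Op$'s traversal path, the procedure $\mathrm{execute\_until\_timestamp}(Op,v)$ (executing in $v$ all operations in $v$'s queue up to and including $Op$) finishes in a finite number of steps.
   Context: Setting: an asynchronous shared-memory system with a finite set $P$ of processes operating on a concurrent binary search tree with a fictive root whose only child is the real root. Every node $v$ has a unique id, a FIFO queue of operation descriptors, and a pointer to an immutable state record containing $\mathrm{Ts\_Mod}$ (the timestamp of the last modifying operation). Each operation $Op$ has a descriptor with a timestamp, a queue $Op.\mathrm{Traverse}$ of nodes, and a map $Op.\mathrm{Processed}$. Execution of $Op$ proceeds as follows. Insert the descriptor into the root queue, which assigns strictly increasing timestamps in insertion order. Set $Op.\mathrm{Traverse}$ to contain the root. While it is nonempty, take its head $v$, run $\mathrm{execute\_until\_timestamp}(Op,v)$, and pop $v$. $\mathrm{execute\_until\_timestamp}(Op,v)$ repeatedly reads the head descriptor $D$ of $v$'s queue and returns if the queue is empty or if $D.\mathrm{Timestamp}>Op.\mathrm{Timestamp}$. Otherwise it executes $D$ in $v$. Executing $D$ in $v$ consists of the following steps. - Compute the children $C$ of $v$ where $D$ continues. - For each $c\in C$: - push $c$ onto $D.\mathrm{Traverse}$; - if $c$'s $\mathrm{Ts\_Mod}<D.\mathrm{Timestamp}$, make one CAS attempt installing a new state reflecting $D$ with $\mathrm{Ts\_Mod}=D.\mathrm{Timestamp}$; - append $D$ to $c$'s queue unless already appended. - Record ($v$'s id, partial result) in $D.\mathrm{Processed}$ if absent. - Remove $D$ from the head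 of $v$'s queue if still there. No step is retried on failure. *)

(* Defs.v *)
(* MathComp (boot) world. Operational model of the concurrent tree algorithm:
   asynchronous shared memory, interleaving semantics, one atomic
   shared-memory access per process step. *)
From mathcomp Require Import all_boot.

Set Implicit Arguments.
Unset Strict Implicit.
Unset Printing Implicit Defensive.

(* Immutable state record of a node: Ts_Mod plus abstract tree content. *)
Record NState (Cont : Type) := MkNState { ts_mod : nat; content : Cont }.

Record Shared (Node Desc Cont Res : Type) := MkShared {
  clock     : nat;                        (* next timestamp of the root queue *)
  tsOf      : Desc -> option nat;
  queue     : Node -> seq Desc;           (* FIFO queue of each node (head first) *)
  appended  : Node -> seq Desc;           (* descriptors ever appended to a node's queue *)
  nstate    : Node -> nat * NState Cont;  (* state pointer (address, record) *)
  alloc     : nat;                        (* next fresh record address *)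
  trav      : Desc -> seq Node;           (* Op.Traverse (head first) *)
  processed : Desc -> seq (Node * Res)
}.

Inductive PC (Node Desc Cont : Type) :=
| PStart    (i : nat)
| PInitTrav (i : nat)
| PLoop     (i : nat)
| PEUT      (i : nat) (v : Node)                       (* execute_until_timestamp: read head of v's queue *)
| PExec     (i : nat) (v : Node) (D : Desc)
| PChild    (i : nat) (v : Node) (D : Desc) (s : NState Cont) (C : seq Node)
| PChildRd  (i : nat) (v : Node) (D : Desc) (s : NState Cont) (c : Node) (C : seq Node)
| PChildCas (i : nat) (v : Node) (D : Desc) (s : NState Cont) (c : Node) (C : seq Node)
            (old : nat)
| PChildApp (i : nat) (v : Node) (D : Desc) (s : NState Cont) (c : Node) (C : seq Node)
| PRecord   (i : nat) (v : Node) (D : Desc) (s : NState Cont)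
| PRemove   (i : nat) (v : Node) (D : Desc)
| PPop      (i : nat) (v : Node).                      (* execute_until_timestamp returned; pop v *)

Arguments PStart {Node Desc Cont}.
Arguments PInitTrav {Node Desc Cont}.
Arguments PLoop {Node Desc Cont}.
Arguments PEUT {Node Desc Cont}.
Arguments PExec {Node Desc Cont}.
Arguments PChild {Node Desc Cont}.
Arguments PChildRd {Node Desc Cont}.
Arguments PChildCas {Node Desc Cont}.
Arguments PChildApp {Node Desc Cont}.
Arguments PRecord {Node Desc Cont}.
Arguments PRemove {Node Desc Cont}.
Arguments PPop {Node Desc Cont}.

Section Model.

Variables (P : finType) (Node Desc : eqType) (Cont Res : Type).
Variable root : Node.                                  (* the fictive root *)
Variable st0 : Node -> NState Cont.
(* children of v where D continues, given the read state of v *)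
Variable cont : Desc -> Node -> NState Cont -> seq Node.
(* the content of a new state of a child reflecting D *)
Variable upd : Desc -> Node -> Cont -> Cont.
(* partial result of D at v, given the read state of v *)
Variable pres : Desc -> Node -> NState Cont -> Res.
(* the i-th operation (descriptor) executed by process p *)
Variable prog : P -> nat -> Desc.

Definition fupd (A : eqType) (B : Type) (f : A -> B) (a : A) (b : B) : A -> B :=
  fun x => if x == a then b else f x.

Notation Sh := (Shared Node Desc Cont Res).
Notation PCt := (PC Node Desc Cont).

Definition set_clock (S : Sh) (n : nat) : Sh := MkShared n (tsOf S) (queue S) (appended S) (nstate S) (alloc S) (trav S) (processed S).
Definition set_tsOf (S : Sh) (f : Desc -> option nat) : Sh := MkShared (clock S) f (queue S) (appended S) (nstate S) (alloc S) (trav S) (processed S).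
Definition set_queue (S : Sh) (f : Node -> seq Desc) : Sh := MkShared (clock S) (tsOf S) f (appended S) (nstate S) (alloc S) (trav S) (processed S).
Definition set_appended (S : Sh) (f : Node -> seq Desc) : Sh := MkShared (clock S) (tsOf S) (queue S) f (nstate S) (alloc S) (trav S) (processed S).
Definition set_nstate (S : Sh) (f : Node -> nat * NState Cont) : Sh := MkShared (clock S) (tsOf S) (queue S) (appended S) f (alloc S) (trav S) (processed S).
Definition set_alloc (S : Sh) (n : nat) : Sh := MkShared (clock S) (tsOf S) (queue S) (appended S) (nstate S) n (trav S) (processed S).
Definition set_trav (S : Sh) (f : Desc -> seq Node) : Sh := MkShared (clock S) (tsOf S) (queue S) (appended S) (nstate S) (alloc S) f (processed S).
Definition set_processed (S : Sh) (f : Desc -> seq (Node * Res)) : Sh := MkShared (clock S) (tsOf S) (queue S) (appended S) (nstate S) (alloc S) (trav S) f.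

Definition tsD (S : Sh) (D : Desc) : nat := odflt 0 (tsOf S D).

Definition step (p : P) (S : Sh) (pc : PCt) : Sh * PCt :=
  match pc with
  | PStart i =>
      let D := prog p i in
      let S1 := set_tsOf S (fupd (tsOf S) D (Some (clock S))) in
      let S2 := set_clock S1 (clock S).+1 in
      let S3 := set_queue S2 (fupd (queue S) root (rcons (queue S root) D)) in
      let S4 := set_appended S3 (fupd (appended S) root (D :: appended S root)) in
      (S4, PInitTrav i)
  | PInitTrav i =>
      (set_trav S (fupd (trav S) (prog p i) [:: root]), PLoop i)
  | PLoop i =>
      match trav S (prog p i) with
      | [::] => (S, PStart i.+1)
      | v :: _ => (S, PEUT i v)
      end
  | PEUT i v =>
      match queue S v with
      | [::] => (S, PPop i v)
      | D :: _ =>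
          match tsOf S D with
          | Some t => if t <= tsD S (prog p i) then (S, PExec i v D)
                      else (S, PPop i v)
          | None => (S, PPop i v)
          end
      end
  | PExec i v D =>
      let s := (nstate S v).2 in (S, PChild i v D s (cont D v s))
  | PChild i v D s C =>
      match C with
      | [::] => (S, PRecord i v D s)
      | c :: C' => (set_trav S (fupd (trav S) D (rcons (trav S D) c)),
                    PChildRd i v D s c C')
      end
  | PChildRd i v D s c C =>
      let (a, r) := nstate S c in
      if ts_mod r < tsD S D then (S, PChildCas i v D s c C a)
      else (S, PChildApp i v D s c C)
  | PChildCas i v D s c C a =>
      let (a', r) := nstate S c in
      if a' == a then
        let S1 := set_nstate S (fupd (nstate S) c
                     (alloc S, MkNState (tsD S D) (upd D c (content r)))) in
        (set_alloc S1 (alloc S).+1, PChildApp i v D s c C)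
      else (S, PChildApp i v D s c C)
  | PChildApp i v D s c C =>
      if D \in appended S c then (S, PChild i v D s C)
      else
        let S1 := set_appended S (fupd (appended S) c (D :: appended S c)) in
        (set_queue S1 (fupd (queue S) c (rcons (queue S c) D)), PChild i v D s C)
  | PRecord i v D s =>
      if has (fun e => e.1 == v) (processed S D) then (S, PRemove i v D)
      else (set_processed S (fupd (processed S) D (rcons (processed S D) (v, pres D v s))),
            PRemove i v D)
  | PRemove i v D =>
      match queue S v with
      | D' :: q => if D' == D then (set_queue S (fupd (queue S) v q), PEUT i v)
                   else (S, PEUT i v)
      | [::] => (S, PEUT i v)
      end
  | PPop i v =>
      (set_trav S (fupd (trav S) (prog p i) (behead (trav S (prog p i)))), PLoop i)
  end.

Definition init_shared : Sh :=
  MkShared 0 (fun _ => None) (fun _ => [::]) (fun _ => [::])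
           (fun v => (0, st0 v)) 1 (fun _ => [::]) (fun _ => [::]).

(* Configuration after n steps of the schedule sched (sched n = process
   taking step n). *)
Fixpoint run (sched : nat -> P) (n : nat) : Sh * (P -> PCt) :=
  match n with
  | 0 => (init_shared, fun _ => PStart 0)
  | n'.+1 =>
      let (S, pcs) := run sched n' in
      let p := sched n' in
      let (S', pc') := step p S (pcs p) in
      (S', fupd pcs p pc')
  end.

End Model.

(* Main.v *)
Require Import Defs.
From mathcomp Require Import all_boot zify.

Set Implicit Arguments.
Unset Strict Implicit.
Unset Printing Implicit Defensive.

(* A timestamp x is pending at v when the descriptor stamped x has not yet been
   appended to v's queue or is still in it.  Descriptors are stamped once and
   appended to a given queue at most once, so a timestamp below the clock that
   has stopped being pending at v never becomes pending again.  Each round of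
   execute_until_timestamp(Op, v) that does not return executes the head D of
   v's queue, whose timestamp is at most Op's, and ends with D off v's queue:
   queues have no duplicates and nothing is ever inserted before their head, so
   D can only have left the head by being removed.  Hence the pending
   timestamps up to Op's strictly decrease from round to round, and a fair
   schedule lets the process take each of the finitely many steps of a round. *)

Section Algorithm.

Variables (P : finType) (Node Desc : eqType) (Cont Res : Type)
  (root : Node) (st0 : Node -> NState Cont)
  (cont : Desc -> Node -> NState Cont -> seq Node)
  (upd : Desc -> Node -> Cont -> Cont)
  (pres : Desc -> Node -> NState Cont -> Res)
  (prog : P -> nat -> Desc).
Hypothesis prog_inj : forall p q i j, prog p i = prog q j -> p = q /\ i = j.

Notation Sh := (Shared Node Desc Cont Res).
Notation PCt := (PC Node Desc Cont).
Notation astep := (step root cont upd pres prog).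

Lemma fupdE (A : eqType) (B : Type) (f : A -> B) a b x :
  fupd f a b x = if x == a then b else f x.
Proof. by []. Qed.

Definition enqueues (S S' : Sh) c D :=
  queue S' = fupd (queue S) c (rcons (queue S c) D) /\
  appended S' = fupd (appended S) c (D :: appended S c).

(* How a step changes the fields that matter for termination; the traversal
   queues, node states and results are irrelevant here. *)
Inductive step_effect (q : P) (S : Sh) : PCt -> Sh -> Prop :=
| EffSilent pc S' of tsOf S' = tsOf S & clock S' = clock S
    & queue S' = queue S & appended S' = appended S : step_effect q S pc S'
| EffStart j S' of tsOf S' = fupd (tsOf S) (prog q j) (Some (clock S))
    & clock S' = (clock S).+1 & enqueues S S' root (prog q j) :
    step_effect q S (PStart j) S'
| EffAppend i v D s c C S' of D \notin appended S c & tsOf S' = tsOf S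
    & clock S' = clock S & enqueues S S' c D :
    step_effect q S (PChildApp i v D s c C) S'
| EffPop pc c S' of tsOf S' = tsOf S & clock S' = clock S
    & appended S' = appended S & queue S' = fupd (queue S) c (behead (queue S c)) :
    step_effect q S pc S'.

Lemma astepP q S pc : step_effect q S pc (astep q S pc).1.
Proof.
case: pc => [j|i|i|i v|i v D|i v D s [|c C]|i v D s c C|i v D s c C a|i v D s c C
  |i v D s|i v D|i v] /=; try exact: EffSilent.
- exact: EffStart.
- by case: (trav S _) => *; apply: EffSilent.
- case: (queue S v) => [|D qq]; first exact: EffSilent.
  by case: (tsOf S D) => [x|]; [case: ifP|]; move=> *; apply: EffSilent.
- by case: (nstate S c) => a' r; case: ifP => _; apply: EffSilent.
- by case: (nstate S c) => a' r; case: ifP => _; apply: EffSilent.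
- by case: ifP => [_|/negbT nD]; [apply: EffSilent | apply: EffAppend].
- by case: ifP => _; apply: EffSilent.
- case E: (queue S v) => [|D' qq]; first exact: EffSilent.
  by case: eqP => _; [apply: (@EffPop _ _ _ v); rewrite ?E | apply: EffSilent].
Qed.

Definition first_unstarted (pc : PCt) : nat :=
  match pc with
  | PStart j => j
  | PInitTrav i | PLoop i | PEUT i _ | PExec i _ _ | PChild i _ _ _ _
  | PChildRd i _ _ _ _ _ | PChildCas i _ _ _ _ _ _ | PChildApp i _ _ _ _ _
  | PRecord i _ _ _ | PRemove i _ _ | PPop i _ => i.+1
  end.

Definition started (pc : PCt) : bool := if pc is PStart _ then false else true.

Definition executing (pc : PCt) : option (Node * Desc) :=
  match pc with
  | PExec _ v D | PChild _ v D _ _ | PChildRd _ v D _ _ _ | PChildCas _ v D _ _ _ _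
  | PChildApp _ v D _ _ _ | PRecord _ v D _ | PRemove _ v D => Some (v, D)
  | _ => None
  end.

Definition queues_wf (S : Sh) :=
  forall c, uniq (queue S c) /\ {subset queue S c <= appended S c}.

Definition shared_wf (S : Sh) :=
  [/\ forall D1 D2 x, tsOf S D1 = Some x -> tsOf S D2 = Some x -> D1 = D2,
      forall D x, tsOf S D = Some x -> x < clock S,
      forall c D, D \in appended S c -> isSome (tsOf S D) &
      queues_wf S].

Definition head_if_queued (S : Sh) v D := D \in queue S v -> ohead (queue S v) = Some D.

Definition proc_wf (S : Sh) (q : P) (pc : PCt) :=
  [/\ forall j, first_unstarted pc <= j -> tsOf S (prog q j) = None,
      started pc -> isSome (tsOf S (prog q (first_unstarted pc).-1)) &
      forall v D, executing pc = Some (v, D) ->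
        [/\ isSome (tsOf S D), D \in appended S v & head_if_queued S v D]].

Definition invariant (S : Sh) (pcs : P -> PCt) :=
  shared_wf S /\ forall r, proc_wf S r (pcs r).

Lemma queues_wf_enqueue S S' c D :
  queues_wf S -> D \notin appended S c -> enqueues S S' c D -> queues_wf S'.
Proof.
move=> wfS nD [eq_q eq_a] c'; rewrite eq_q eq_a !fupdE; case: eqP => [_|_]; last exact: wfS.
have [uq sub] := wfS c; split.
  by rewrite rcons_uniq uq andbT; apply: contra nD; apply: sub.
by move=> D'; rewrite mem_rcons !inE => /orP [->|/sub ->]; rewrite ?orbT.
Qed.

Lemma queues_wf_pop S S' c :
  queues_wf S -> appended S' = appended S ->
  queue S' = fupd (queue S) c (behead (queue S c)) -> queues_wf S'.
Proof.
move=> wfS eq_a eq_q c'; rewrite eq_a eq_q fupdE; case: eqP => [->|_]; last exact: wfS.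
have [] := wfS c; case: (queue S c) => //= D0 qq /andP [_ uq] sub; split=> // D' hD'.
by apply: sub; rewrite inE hD' orbT.
Qed.

Lemma head_if_queued_enqueue S S' c D0 v D :
  D0 \notin appended S c -> enqueues S S' c D0 -> D \in appended S v ->
  head_if_queued S v D -> head_if_queued S' v D.
Proof.
rewrite /head_if_queued => nD0 [-> _] hD hd; rewrite fupdE; case: eqP => [Evc|_]; last exact: hd.
subst c; rewrite mem_rcons inE => /orP [/eqP ED|/[dup] /hd].
  by rewrite -ED hD in nD0.
by case: (queue S v).
Qed.

Lemma head_if_queued_pop S S' c v D :
  uniq (queue S c) -> queue S' = fupd (queue S) c (behead (queue S c)) ->
  head_if_queued S v D -> head_if_queued S' v D.
Proof.
rewrite /head_if_queued => uq -> hd; rewrite fupdE; case: eqP => [Evc|_]; last exact: hd.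
subst c; case E: (queue S v) hd uq => [|D' qq] //= hd /andP [nD' _] hD.
have [ED'] : Some D' = Some D by apply: hd; rewrite inE hD orbT.
by rewrite ED' hD in nD'.
Qed.

Lemma proc_wf_start S q j : shared_wf S -> proc_wf S q (PStart j) ->
  tsOf S (prog q j) = None /\ forall c, prog q j \notin appended S c.
Proof.
move=> [_ _ stamped _] [unst _ _]; have fresh := unst j (leqnn j).
by split=> // c; apply/negP => /stamped; rewrite fresh.
Qed.

Lemma shared_wf_effect q S pc S' :
  shared_wf S -> proc_wf S q pc -> step_effect q S pc S' -> shared_wf S'.
Proof.
move=> wf pwf eff; have [inj ts_lt stamped qwf] := wf.
case: pc S' / eff pwf => [pc S' eq_ts eq_clk eq_q eq_a _|j S' eq_ts eq_clk enq pwf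
  |i v D s c C S' nD eq_ts eq_clk enq pwf|pc c S' eq_ts eq_clk eq_a eq_q _].
- by rewrite /shared_wf /queues_wf eq_ts eq_clk eq_q eq_a.
- have [fresh nA] := proc_wf_start wf pwf.
  split; rewrite ?eq_ts ?eq_clk.
  + move=> D1 D2 x; rewrite !fupdE.
    case: eqP => [->|_]; case: eqP => [->|_] //; last exact: inj.
    * by move=> [<-] /ts_lt; rewrite ltnn.
    * by move=> /ts_lt + [E]; rewrite E ltnn.
  + by move=> D x; rewrite fupdE; case: eqP => [_ [<-] //|_ /ts_lt /ltnW].
  + move=> c D; rewrite fupdE; case: eqP => // nD.
    case: enq => _ ->; rewrite fupdE; case: eqP => [_|_]; last exact: stamped.
    by rewrite inE => /orP [/eqP /nD|/stamped].
  + exact: queues_wf_enqueue (nA root) enq.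
- have [_ _ exe] := pwf; have [stD _ _] := exe v D erefl.
  split; rewrite ?eq_ts ?eq_clk //; last exact: queues_wf_enqueue enq.
  move=> c' D'; case: enq => _ ->; rewrite fupdE; case: eqP => [_|_]; last exact: stamped.
  by rewrite inE => /orP [/eqP ->|/stamped].
- split; rewrite ?eq_ts ?eq_clk ?eq_a //; exact: queues_wf_pop eq_a eq_q.
Qed.

Lemma appended_enqueue S S' c D0 v :
  enqueues S S' c D0 -> {subset appended S v <= appended S' v}.
Proof. by case=> _ -> D; rewrite fupdE; case: eqP => // -> hD; rewrite inE hD orbT. Qed.

Lemma proc_wf_enqueue S S' r pcr c D0 :
  D0 \notin appended S c -> enqueues S S' c D0 ->
  (forall X, isSome (tsOf S X) -> isSome (tsOf S' X)) ->
  (forall j, tsOf S (prog r j) = None -> tsOf S' (prog r j) = None) ->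
  proc_wf S r pcr -> proc_wf S' r pcr.
Proof.
move=> nD0 enq stamp unst [fut cur exe]; split=> [j /fut /unst //|/cur /stamp //|v D /exe].
move=> [stD apD hd]; split; first exact: stamp.
  exact: appended_enqueue enq _ apD.
exact: head_if_queued_enqueue enq apD hd.
Qed.

Lemma proc_wf_pop S S' r pcr c :
  queues_wf S -> tsOf S' = tsOf S -> appended S' = appended S ->
  queue S' = fupd (queue S) c (behead (queue S c)) ->
  proc_wf S r pcr -> proc_wf S' r pcr.
Proof.
move=> qwf eq_ts eq_a eq_q [fut cur exe]; split; rewrite ?eq_ts //.
move=> v D /exe [stD apD hd]; split; rewrite ?eq_a //.
by have [uq _] := qwf c; apply: head_if_queued_pop eq_q hd.
Qed.

Lemma proc_wf_effect q r S pc pcr S' :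
  shared_wf S -> proc_wf S q pc -> step_effect q S pc S' ->
  (forall j, pc = PStart j -> r <> q) -> proc_wf S r pcr -> proc_wf S' r pcr.
Proof.
move=> wf pwf eff; have [_ _ _ qwf] := wf.
case: pc S' / eff pwf => [pc S' eq_ts _ eq_q eq_a|j S' eq_ts _ enq
  |i v D s c C S' nD eq_ts _ enq|pc c S' eq_ts _ eq_a eq_q] pwf notq.
- by rewrite /proc_wf /head_if_queued eq_ts eq_q eq_a.
- have [fresh nA] := proc_wf_start wf pwf.
  apply: proc_wf_enqueue (nA root) enq _ _ => [X|j']; rewrite eq_ts fupdE.
    by case: eqP => // ->; rewrite fresh.
  by case: eqP => // /prog_inj [/(notq j erefl)].
- by apply: proc_wf_enqueue nD enq _ _; rewrite eq_ts.
- exact: proc_wf_pop qwf eq_ts eq_a eq_q.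
Qed.

Lemma own_step_shape q S pc : started pc ->
  let: (S', pc') := astep q S pc in
  first_unstarted pc' = first_unstarted pc /\
      [\/ executing pc' = None, executing pc' = executing pc |
          exists v D, [/\ executing pc' = Some (v, D), S' = S,
                          ohead (queue S v) = Some D & isSome (tsOf S D)]].
Proof.
case: pc => [j|i|i|i v|i v D|i v D s [|c C]|i v D s c C|i v D s c C a|i v D s c C
  |i v D s|i v D|i v] //= _; try by split; try constructor.
- by case: (trav S _) => *; split; try constructor.
- case E: (queue S v) => [|D qq]; first by split; constructor.
  case Et: (tsOf S D) => [x|]; last by split; constructor.
  case: ifP => _; split=> //; last by constructor.
  by apply: Or33; exists v, D; rewrite E Et.
- by case: (nstate S c) => a' r; case: ifP => _; split; try constructor.
- by case: (nstate S c) => a' r; case: ifP => _; split; try constructor.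
- by case: ifP => _; split; try constructor.
- by case: ifP => _; split; try constructor.
- by case: (queue S v) => [|D' qq]; [|case: ifP => _]; split; constructor.
Qed.

Lemma proc_wf_own q S pc : shared_wf S -> proc_wf S q pc ->
  proc_wf (astep q S pc).1 q (astep q S pc).2.
Proof.
move=> wf pwf; have eff := astepP q S pc; have wf' := shared_wf_effect wf pwf eff.
case: (boolP (started pc)) => st; last first.
  case: pc st pwf {eff wf'} => // j _ [fut _ _]; split=> //= [j' lt_j|]; rewrite fupdE ?eqxx //.
  by case: eqP => [/prog_inj [_ E]|_]; [rewrite E ltnn in lt_j | apply/fut/ltnW].
have not_start j : pc = PStart j -> q <> q by move=> E; rewrite E in st.
have [fut cur exe] := proc_wf_effect wf pwf eff not_start pwf.
move: (own_step_shape q S st) wf' fut cur exe; case: (astep q S pc) => S' pc' /=.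
move=> [fu ex'] [_ _ _ qwf] fut cur exe.
split=> [j|_|v D]; rewrite ?fu; [exact: fut | exact: cur |].
case: ex' => [-> //|-> /exe //|[v' [D' [-> ES hd stD [<- <-]]]]]; subst S'.
have [_ sub] := qwf v'; split=> //.
by apply: sub; move: hd; case: (queue S v') => //= D0 qq [->]; rewrite inE eqxx.
Qed.

Lemma invariant_step q S pcs : invariant S pcs ->
  invariant (astep q S (pcs q)).1 (fupd pcs q (astep q S (pcs q)).2).
Proof.
move=> [wf pwf]; split; first exact: shared_wf_effect (pwf q) (astepP _ _ _).
move=> r; rewrite fupdE; case: eqP => [->|nrq]; first exact: proc_wf_own.
exact: proc_wf_effect (pwf q) (astepP _ _ _) (fun _ _ => nrq) (pwf r).
Qed.

Definition pending (S : Sh) v x :=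
  exists2 D, tsOf S D = Some x & (D \notin appended S v) || (D \in queue S v).

Definition covers (S : Sh) v T (A : seq nat) :=
  forall x, x <= T -> pending S v x -> x \in A.

Lemma unappended_or_queued_enqueue S S' c D0 v D :
  D0 \notin appended S c -> enqueues S S' c D0 ->
  (D \notin appended S' v) || (D \in queue S' v) ->
  (D \notin appended S v) || (D \in queue S v).
Proof.
move=> nD0 [-> ->]; rewrite !fupdE; case: eqP => [->|//].
case: (eqVneq D D0) => [->|nD]; first by rewrite nD0.
by rewrite inE mem_rcons inE (negbTE nD).
Qed.

Lemma effect_mono q S pc S' :
  shared_wf S -> proc_wf S q pc -> step_effect q S pc S' ->
  [/\ clock S <= clock S',
      forall D x, tsOf S D = Some x -> tsOf S' D = Some x,
      forall c, {subset appended S c <= appended S' c} &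
      forall v x, x < clock S -> pending S' v x -> pending S v x].
Proof.
move=> wf pwf eff; case: pc S' / eff pwf => [pc S' eq_ts -> eq_q eq_a|j S' eq_ts -> enq
  |i v D s c C S' nD eq_ts -> enq|pc c S' eq_ts -> eq_a eq_q] pwf.
- by split=> // [D x|c|v x _]; rewrite /pending ?eq_ts ?eq_q ?eq_a.
- have [fresh nA] := proc_wf_start wf pwf.
  split=> // [D x|c|v x lt_x [D]].
  + by rewrite eq_ts fupdE; case: eqP => [->|//]; rewrite fresh.
  + exact: appended_enqueue enq.
  + rewrite eq_ts fupdE; case: eqP => [_ [E]|_ hD]; first by rewrite E ltnn in lt_x.
    by move/(unappended_or_queued_enqueue (nA root) enq); exists D.
- split=> // [D' x|c'|v' x _ [D']]; rewrite ?eq_ts //.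
  + exact: appended_enqueue enq.
  + by move=> hD /(unappended_or_queued_enqueue nD enq); exists D'.
- split=> // [D x|c'|v x _ [D]]; rewrite ?eq_ts ?eq_a //.
  move=> hD; rewrite eq_q fupdE; case: eqP => [->|_ hq]; last by exists D; rewrite ?hD.
  by move=> /orP [hn|/mem_behead hq]; exists D; rewrite ?hn ?hq ?orbT.
Qed.

Lemma astep_eut q S i v :
  (astep q S (PEUT i v)).2 = PPop i v \/
  exists D x, [/\ ohead (queue S v) = Some D, tsOf S D = Some x,
                  x <= tsD S (prog q i) & (astep q S (PEUT i v)).2 = PExec i v D].
Proof.
rewrite /=; case: (queue S v) => [|D qq]; first by left.
case Et: (tsOf S D) => [x|]; last by left.
by case: ifP => le_x; [right; exists D, x | left].
Qed.

Lemma astep_remove q S i v D : uniq (queue S v) -> head_if_queued S v D ->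
  (astep q S (PRemove i v D)).2 = PEUT i v /\ D \notin queue (astep q S (PRemove i v D)).1 v.
Proof.
rewrite /head_if_queued /=; case E: (queue S v) => [|D' qq] uq hd; rewrite ?E //=.
case: (D' =P D) => [<-|nD] /=; first by rewrite fupdE eqxx; case/andP: uq.
by rewrite E; split=> //; apply/negP => /hd [/nD].
Qed.

Definition in_exec_body i v D (pc : PCt) : bool :=
  match pc with
  | PChild i' v' D' _ _ | PChildRd i' v' D' _ _ _ | PChildCas i' v' D' _ _ _ _
  | PChildApp i' v' D' _ _ _ | PRecord i' v' D' _ => [&& i' == i, v' == v & D' == D]
  | _ => false
  end.

(* Each remaining child costs at most four steps: push, read, CAS, append. *)
Definition exec_body_rank (pc : PCt) : nat :=
  match pc with
  | PChild _ _ _ _ C => 4 * size C + 1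
  | PChildRd _ _ _ _ _ C => 4 * size C + 4
  | PChildCas _ _ _ _ _ C _ => 4 * size C + 3
  | PChildApp _ _ _ _ _ C => 4 * size C + 2
  | _ => 0
  end.

Lemma astep_exec_body q S i v D pc : in_exec_body i v D pc ->
  (astep q S pc).2 = PRemove i v D \/
  in_exec_body i v D (astep q S pc).2 /\ exec_body_rank (astep q S pc).2 < exec_body_rank pc.
Proof.
case: pc => //= [i' v' D' s [|c C]|i' v' D' s c C|i' v' D' s c C a|i' v' D' s c C|i' v' D' s]
  /and3P [/eqP -> /eqP -> /eqP ->] /=; rewrite ?eqxx.
- by right.
- by right; split=> //; lia.
- by case: (nstate S c) => a r; case: ifP => _ /=; right; rewrite !eqxx; split=> //; lia.
- by case: (nstate S c) => a' r; case: ifP => _ /=; right; rewrite !eqxx; split=> //; lia.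
- by case: ifP => _ /=; right; rewrite !eqxx; split=> //; lia.
- by case: ifP => _; left.
Qed.

Variable sched : nat -> P.
Notation cfg n := (run root st0 cont upd pres prog sched n).

Lemma cfg_succ n : cfg n.+1 =
  ((astep (sched n) (cfg n).1 ((cfg n).2 (sched n))).1,
   fupd (cfg n).2 (sched n) (astep (sched n) (cfg n).1 ((cfg n).2 (sched n))).2).
Proof. by rewrite /=; case: (run _ _ _ _ _ _ _ n) => S pcs; case: step. Qed.

Lemma invariant_cfg n : invariant (cfg n).1 (cfg n).2.
Proof.
elim: n => [|n IH]; first by split=> [|r]; split.
by rewrite cfg_succ; apply: invariant_step.
Qed.

Lemma cfg_mono n m : n <= m ->
  [/\ clock (cfg n).1 <= clock (cfg m).1,
      forall D x, tsOf (cfg n).1 D = Some x -> tsOf (cfg m).1 D = Some x,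
      forall c, {subset appended (cfg n).1 c <= appended (cfg m).1 c} &
      forall v x, x < clock (cfg n).1 -> pending (cfg m).1 v x -> pending (cfg n).1 v x].
Proof.
move/subnK <-; elim: (m - n) => [|k [le_clk ts_n ap_n pend_n]].
  by rewrite add0n; split=> // c.
have [wf pwf] := invariant_cfg (k + n).
have [le_clk' ts' ap' pend'] := effect_mono wf (pwf (sched (k + n))) (astepP _ _ _).
rewrite addSn cfg_succ /=; split=> [|D x /ts_n /ts' //|c D /ap_n /ap' //|v x lt_x /pend'].
  exact: leq_trans le_clk'.
by move=> /(_ (leq_trans lt_x le_clk)); apply: pend_n.
Qed.

Lemma turn_pc n q : sched n = q -> (cfg n.+1).2 q = (astep q (cfg n).1 ((cfg n).2 q)).2.
Proof. by move=> <-; rewrite cfg_succ /= fupdE eqxx. Qed.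

Lemma turn_shared n q : sched n = q -> (cfg n.+1).1 = (astep q (cfg n).1 ((cfg n).2 q)).1.
Proof. by move=> <-; rewrite cfg_succ. Qed.

Lemma pc_other n r : sched n != r -> (cfg n.+1).2 r = (cfg n).2 r.
Proof. by rewrite cfg_succ /= fupdE eq_sym => /negbTE ->. Qed.

Section Fairness.

Variable p : P.
Hypothesis fair : forall T, exists2 t', T <= t' & sched t' = p.

Lemma fair_turn n : exists m, [/\ n <= m, (cfg m).2 p = (cfg n).2 p & sched m = p].
Proof.
have [t' le_nt st'] := fair n.
have turn : exists m, (n <= m) && (sched m == p) by exists t'; rewrite le_nt st' eqxx.
have [m /andP [le_nm /eqP smp] min_m] := ex_minnP turn.
have pc_before k : n + k <= m -> (cfg (n + k)).2 p = (cfg n).2 p.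
  elim: k => [|k IH] le_k; first by rewrite addn0.
  rewrite addnS pc_other; first by apply: IH; lia.
  by apply/eqP => snk; have := min_m (n + k); rewrite snk eqxx leq_addr => /(_ isT); lia.
by exists m; rewrite -{1 2}(subnKC le_nm) pc_before ?subnKC.
Qed.

Lemma exec_body_reaches_remove i v D n : in_exec_body i v D ((cfg n).2 p) ->
  exists2 m, n <= m & (cfg m).2 p = PRemove i v D.
Proof.
have [k] := ubnP (exec_body_rank ((cfg n).2 p)); elim: k n => // k IH n lt_k inb.
have [m [le_nm pcm smp]] := fair_turn n.
have := astep_exec_body p (cfg m).1 inb; rewrite -pcm -turn_pc //.
case=> [pc_rem|[inb' lt_rank]]; first by exists m.+1 => //; lia.
have lt_k' : exec_body_rank ((cfg m.+1).2 p) < k.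
  by rewrite -ltnS; apply: leq_trans lt_k; rewrite -pcm.
by have [m' le_m' pc_rem] := IH m.+1 lt_k' inb'; exists m' => //; lia.
Qed.

Lemma exec_clears_pending i v D x n :
  (cfg n).2 p = PExec i v D -> tsOf (cfg n).1 D = Some x ->
  exists2 m, n <= m & (cfg m).2 p = PEUT i v /\ ~ pending (cfg m).1 v x.
Proof.
move=> pcn tsD.
have [m1 [le_n1 pc1 s1]] := fair_turn n.
have body : in_exec_body i v D ((cfg m1.+1).2 p) by rewrite turn_pc // pc1 pcn /= !eqxx.
have [m2 le_12 pc2] := exec_body_reaches_remove body.
have [m3 [le_23 pc3 s3]] := fair_turn m2.
have [[_ _ _ qwf] pwf] := invariant_cfg m3.
have [_ _ /(_ v D)] := pwf p; rewrite pc3 pc2 => /(_ erefl) [_ apD hd].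
have [pc4 nqD] := astep_remove p i (proj1 (qwf v)) hd.
have le_n4 : n <= m3.+1 by lia.
exists m3.+1 => //; split; first by rewrite turn_pc // pc3 pc2.
have [[inj _ _ _] _] := invariant_cfg m3.+1.
have [_ ts_4 _ _] := cfg_mono le_n4.
have [_ _ ap_4 _] := cfg_mono (leqnSn m3).
move=> [D' /inj /(_ (ts_4 _ _ tsD)) ->].
by rewrite ap_4 // (turn_shared s3) pc3 pc2 (negbTE nqD).
Qed.

Lemma eut_round i v T A n :
  (cfg n).2 p = PEUT i v -> tsOf (cfg n).1 (prog p i) = Some T -> covers (cfg n).1 v T A ->
  exists2 m, n <= m & (cfg m).2 p = PPop i v \/
    (cfg m).2 p = PEUT i v /\ exists2 A', size A' < size A & covers (cfg m).1 v T A'.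
Proof.
move=> pcn tsT cov.
have [[_ lt_clk _ _] _] := invariant_cfg n; have lt_T := lt_clk _ _ tsT.
have [m1 [le_n1 pc1 s1]] := fair_turn n.
have [_ ts_1 _ pend_1] := cfg_mono le_n1.
have [pop|[D [x [hd tsx le_x exe]]]] := astep_eut p (cfg m1).1 i v.
  by exists m1.+1; [lia | left; rewrite turn_pc // pc1 pcn].
have le_xT : x <= T by move: le_x; rewrite /tsD (ts_1 _ _ tsT).
have xA : x \in A.
  apply: cov le_xT (pend_1 _ _ (leq_ltn_trans le_xT lt_T) _); exists D => //.
  by move: hd; case: (queue _ v) => //= D0 qq [->]; rewrite inE eqxx orbT.
have pc_exec : (cfg m1.+1).2 p = PExec i v D by rewrite turn_pc // pc1 pcn.
have [_ ts_2 _ _] := cfg_mono (leqnSn m1).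
have [m2 le_2 [pc2 npend]] := exec_clears_pending pc_exec (ts_2 _ _ tsx).
have le_n2 : n <= m2 by lia.
exists m2 => //; right; split=> //; exists (rem x A).
  by rewrite size_rem // ltn_predL; case: (A) xA.
move=> y le_y pend_y; have [_ _ _ pend_2] := cfg_mono le_n2.
have := cov y le_y (pend_2 _ _ (leq_ltn_trans le_y lt_T) pend_y).
rewrite (perm_mem (perm_to_rem xA)) inE => /orP [/eqP Eyx|//].
by rewrite Eyx in pend_y.
Qed.

Lemma eut_returns i v n : (cfg n).2 p = PEUT i v ->
  exists2 m, n <= m & (cfg m).2 p = PPop i v.
Proof.
move=> pcn; have [_ /(_ p) [_ + _]] := invariant_cfg n; rewrite pcn => /(_ isT) /=.
case tsT: (tsOf _ (prog p i)) => [T|] // _.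
have cov : covers (cfg n).1 v T (iota 0 T.+1) by move=> x le_x _; rewrite mem_iota.
move: (iota 0 T.+1) cov => A cov; have [k] := ubnP (size A).
elim: k n A pcn tsT cov => // k IH n A pcn tsT cov lt_k.
have [m le_nm [pop|[pcm [A' lt_A' cov']]]] := eut_round pcn tsT cov; first by exists m.
have [_ ts_m _ _] := cfg_mono le_nm.
have lt_k' : size A' < k by lia.
by have [m' le_m' pop] := IH m A' pcm (ts_m _ _ tsT) cov' lt_k'; exists m' => //; lia.
Qed.

End Fairness.

End Algorithm.

Theorem lemma2 (P : finType) (Node Desc : eqType) (Cont Res : Type)
  (root : Node) (st0 : Node -> NState Cont)
  (cont : Desc -> Node -> NState Cont -> seq Node)
  (upd : Desc -> Node -> Cont -> Cont)
  (pres : Desc -> Node -> NState Cont -> Res)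
  (prog : P -> nat -> Desc)
  (prog_inj : forall p q i j, prog p i = prog q j -> p = q /\ i = j)
  (sched : nat -> P) (t : nat) (p : P) (i : nat) (v : Node) :
  (run root st0 cont upd pres prog sched t).2 p = PEUT i v ->
  (forall T, exists2 t', T <= t' & sched t' = p) ->
  exists2 t', t <= t' & (run root st0 cont upd pres prog sched t').2 p = PPop i v.
Proof. by move=> pct fair; apply: eut_returns. Qed.
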